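(* Let $0<|q|<1$ and let $u,v\in\mathbb{C}$ satisfy $|uv|<|q|$. Then \[ \sum_{i,j\geq0}\frac{(-1)^{i+j}u^{i}v^{j}q^{((i-j)^{2}-i-j)/2}}{(q;q)_{i}(q;q)_{j}}= \frac{(u,v;q)_{\infty}}{(uv/q;q)_{\infty}}. \]
   Context: For $a\in\mathbb{C}$: $(a;q)_0=1$, $(a;q)_n=\prod_{k=0}^{n-1}(1-aq^k)$, $(a;q)_\infty=\prod_{k\ge0}(1-aq^k)$, and $(a_1,\dots,a_m;q)_n=(a_1;q)_n\cdots(a_m;q)_n$ for $n\in\mathbb{N}\cup\{\infty\}$. *)

(* Defs.v *)
From HB Require Import structures.
From mathcomp Require Import all_boot all_order all_algebra.
From mathcomp Require Import finmap complex.
From mathcomp Require Import all_classical all_reals all_analysis.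
From mathcomp Require Import showcase.summability.

Set Implicit Arguments.
Unset Strict Implicit.
Unset Printing Implicit Defensive.

Import Order.TTheory GRing.Theory Num.Theory.
Import numFieldNormedType.Exports.

Local Open Scope classical_set_scope.
Local Open Scope ring_scope.

Definition qpoch (K : numFieldType) (a q : K) (n : nat) : K :=
  \prod_(k < n) (1 - a * q ^+ k).

(* limn is total, with a junk value for divergent sequences; for K = R[i] and
   `|q| < 1 the finite products do converge. *)
Definition qpoch_inf (K : numFieldType) (a q : K) : K :=
  limn (fun n => qpoch a q n).

(* Unordered summation over nat * nat: the finite partial sums converge to l
   along the finite subsets of nat * nat directed by inclusion.  For K = R[i]
   this means that the double series converges absolutely, with sum l, so
   that l is also the value of both iterated sums. *)
Definition has_double_sum (K : numFieldType) (f : nat -> nat -> K) (l : K) :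
    Prop :=
  partial_sum (fun ij : nat * nat => f ij.1 ij.2) @ totally --> l.

(* (i - j)^2 - i - j is even, so the Euclidean quotient by 2 is exact; the
   result may be negative (it equals - i when i = j). *)
Definition qexponent (i j : nat) : int :=
  (((i%:Z - j%:Z) ^+ 2 - i%:Z - j%:Z) %/ 2)%Z.

(* Main.v *)
(* The exponent is C(i,2) + C(j,2) - i j, so for fixed j the sum over i is
   Euler's series for (u q^-j; q)_oo = (u q^-j; q)_j (u; q)_oo.  Pulling the
   finite factor into the remaining sum over j leaves Cauchy's q-binomial series
     sum_j prod_(k < j) (z - v q^k) / (1 - q^(k+1)) = (v; q)_oo / (z; q)_oo
   with z = u v / q.  This sum G(z, v) satisfies
   (1 - z) G(z, v) = (1 - v) G(z q, v q), which is iterated using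
   G(z q^n, v q^n) -> 1; Euler's series is the case z = 0.
   Absolute convergence of the double series needs no separate estimate: it is
   dominated by the same series with (q, u, v) replaced by (|q|, -|u|, -|v|),
   whose terms are nonnegative and whose iterated sums are given by the same
   formulas. *)

Require Import Defs.
From HB Require Import structures.
From mathcomp Require Import all_boot all_order all_algebra.
From mathcomp Require Import finmap complex.
From mathcomp Require Import all_classical all_reals all_analysis.
From mathcomp Require Import showcase.summability.
From mathcomp Require Import ring.

Set Implicit Arguments.
Unset Strict Implicit.

Import Order.TTheory GRing.Theory Num.Theory.
Import numFieldNormedType.Exports.

Local Open Scope ring_scope.
Local Open Scope complex_scope.
Local Open Scope classical_set_scope.

(** * Completeness and limits over a partially ordered field *)

(** Completeness in the form in which the proof uses it. Norms take values in [K] itself, so the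
    same hypothesis serves the series in q, u, v and its majorant in [|q|], [- |u|], [- |v|]. *)
Definition series_complete (K : numFieldType) : Prop :=
  forall (a : nat -> K) (M : K), (forall n, \sum_(k < n) `|a k| <= M) ->
  cvgn (fun n => \sum_(k < n) a k).

Lemma cvgn_unique (K : numFieldType) (x : nat -> K) (l l' : K) :
  x n @[n --> \oo] --> l -> x n @[n --> \oo] --> l' -> l = l'.
Proof.
by move=> xl xl'; apply: (cvg_unique _ xl xl'); exact: norm_hausdorff.
Qed.

Lemma limn_eq (K : numFieldType) (x : nat -> K) (l : K) :
  x n @[n --> \oo] --> l -> limn x = l.
Proof. by move=> xl; apply: cvg_lim => //; exact: norm_hausdorff. Qed.

(* [0 <= y] is the closed condition [`|y| = y], so no totality of the order is
   needed. *)
Lemma cvgn_ge0 (K : numFieldType) (x : nat -> K) (l : K) :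
  (forall n, 0 <= x n) -> x n @[n --> \oo] --> l -> 0 <= l.
Proof.
move=> x_ge0 xl; rewrite -(_ : `|l| = l) ?normr_ge0 //.
have : `|x n| @[n --> \oo] --> `|l| by exact: cvg_norm.
rewrite (_ : (fun n => _) = x) => [/cvgn_unique|]; first exact.
by apply/funext => n; rewrite ger0_norm.
Qed.

Lemma cvgn_ge (K : numFieldType) (x : nat -> K) (l b : K) :
  (forall n, b <= x n) -> x n @[n --> \oo] --> l -> b <= l.
Proof.
move=> b_le xl; rewrite -subr_ge0; apply: (@cvgn_ge0 _ (fun n => x n - b)).
  by move=> n; rewrite subr_ge0.
by apply: cvgB => //; exact: cvg_cst.
Qed.

Lemma cvgn_le (K : numFieldType) (x : nat -> K) (l b : K) :
  (forall n, x n <= b) -> x n @[n --> \oo] --> l -> l <= b.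
Proof.
move=> b_ge xl; rewrite -lerN2; apply: (@cvgn_ge _ (fun n => - x n)).
  by move=> n; rewrite lerN2.
exact: cvgN.
Qed.

Lemma cvgnS (K : numFieldType) (x : nat -> K) (l : K) :
  x n @[n --> \oo] --> l -> x n.+1 @[n --> \oo] --> l.
Proof. by move=> xl; rewrite (cvg_shiftS x). Qed.

Lemma psum_le_lim (K : numFieldType) (a : nat -> K) (l : K) :
  (forall k, 0 <= a k) -> \sum_(k < n) a k @[n --> \oo] --> l ->
  forall n, \sum_(k < n) a k <= l.
Proof.
move=> a_ge0 al n; apply: (@cvgn_ge _ (fun m => \sum_(k < m + n) a k)).
  move=> m; rewrite addnC big_split_ord /= lerDl sumr_ge0 //.
by rewrite (cvg_shiftn n (fun m => \sum_(k < m) a k)).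
Qed.

Lemma bounded_geometric (K : numFieldType) (r : K) : 0 <= r -> r < 1 ->
  forall n, \sum_(k < n) `|r ^+ k| <= (1 - r)^-1.
Proof.
move=> r0 r1 n; under eq_bigr do rewrite normrX (ger0_norm r0).
rewrite -[leRHS]mul1r ler_pdivlMr ?subr_gt0 // mulrC.
by rewrite -opprB mulNr -subrX1 opprB gerBl exprn_ge0.
Qed.

(** [K] is not assumed Archimedean: the powers of [|q|] tend to 0 as the terms of a geometric series
    that converges by completeness. *)
Lemma cvgn_expr0 (K : numFieldType) (q : K) : series_complete K ->
  `|q| < 1 -> q ^+ n @[n --> \oo] --> 0.
Proof.
move=> Kc q1; have := @bounded_geometric K `|q| (normr_ge0 q) q1.
move=> /Kc H; have : `|q| ^+ n @[n --> \oo] --> 0.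
  apply: (@cvg_series_cvg_0 K K).
  rewrite (_ : series _ = fun n => \sum_(k < n) `|q| ^+ k) //.
  by apply/funext => n; rewrite /series /= big_mkord.
move=> /cvgrPdist_lt qn; apply/cvgrPdist_lt => e /qn.
by apply: filterS => n; rewrite !sub0r !normrN normrX normr_id -normrX.
Qed.

Lemma bounded_ratio (K : numFieldType) (a : nat -> K) (r : K) (N : nat) :
  (forall k, 0 <= a k) -> 0 <= r -> r < 1 ->
  (forall k, (N <= k)%N -> a k.+1 <= r * a k) ->
  exists M, forall n, \sum_(k < n) a k <= M.
Proof.
move=> a0 r0 r1 ar; exists (\sum_(k < N) a k + a N / (1 - r)) => n.
have r1' : 0 < 1 - r by rewrite subr_gt0.
(* Partial sum plus geometric bound on the tail: this quantity is nonincreasing in [m]. *)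
have H m : \sum_(k < N + m) a k + a (N + m)%N / (1 - r) <=
    \sum_(k < N) a k + a N / (1 - r).
  elim: m => [|m]; first by rewrite addn0.
  apply: le_trans; rewrite addnS big_ord_recr /= -addrA lerD2l.
  rewrite -lerBrDr -mulrBl ler_pdivlMr //.
  by rewrite mulrBr mulr1 lerD2l lerN2 mulrC ar ?leq_addr.
apply: le_trans (H n); rewrite addnC big_split_ord /= -addrA lerDl.
by rewrite addr_ge0 ?sumr_ge0 // divr_ge0 // ltW.
Qed.

(** * Cauchy's q-binomial series *)

(** For z nonzero this is z^j (v/z; q)_j / (q; q)_j; the product form also makes sense at z = 0,
    where it gives Euler's series. *)
Definition cauchy_term (K : numFieldType) (q z v : K) (j : nat) : K :=
  \prod_(k < j) ((z - v * q ^+ k) / (1 - q ^+ k.+1)).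

Lemma one_sub_expr_neq0 (K : numFieldType) (q : K) (k : nat) :
  `|q| < 1 -> 1 - q ^+ k.+1 != 0.
Proof.
move=> q1; rewrite subr_eq0; apply/negP => /eqP e.
have : `|q ^+ k.+1| < 1 by rewrite normrX exprn_ilt1.
by rewrite -e normr1 ltxx.
Qed.

Lemma cauchy_termS (K : numFieldType) (q z v : K) (j : nat) : `|q| < 1 ->
  (1 - q ^+ j.+1) * cauchy_term q z v j.+1 =
  (z - v * q ^+ j) * cauchy_term q z v j.
Proof.
move=> q1; rewrite /cauchy_term big_ord_recr /=.
by field; rewrite one_sub_expr_neq0.
Qed.

(** Each of the j numerators is homogeneous of degree one in (z, v). Both the functional equation
    and the limit of its iterates rest on this scaling. *)
Lemma cauchy_term_shift (K : numFieldType) (q z v : K) (n j : nat) :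
  cauchy_term q (z * q ^+ n) (v * q ^+ n) j =
  q ^+ (n * j) * cauchy_term q z v j.
Proof.
have -> : q ^+ (n * j) = \prod_(k < j) q ^+ n.
  by rewrite prodr_const card_ord exprM.
rewrite /cauchy_term -big_split /=.
by apply: eq_bigr => k _; rewrite !mulrA; congr (_ / _); ring.
Qed.

(** Ratio test: the quotient of successive terms tends to z, so its norm is eventually below the
    midpoint [r] of [|z|] and 1. *)
Lemma cauchy_term_bounded (K : numFieldType) (q z v : K) : series_complete K ->
  `|q| < 1 -> `|z| < 1 ->
  exists M, forall n, \sum_(k < n) `|cauchy_term q z v k| <= M.
Proof.
move=> Kc q1 z1; pose r := (`|z| + 1) / 2.
have [zr r1] : `|z| < r /\ r < 1 by rewrite /r !midf_lt.
have r0 : 0 < r by exact: le_lt_trans (normr_ge0 z) zr.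
(* [d] solves |z| + |v| d = r (1 - d), so the ratio is at most [r] once |q|^k < d. *)
pose d := (r - `|z|) / (`|v| + r).
have vr : 0 < `|v| + r by rewrite ltr_wpDl.
have d0 : 0 < d by rewrite divr_gt0 // subr_gt0.
have /cvgrPdist_lt /(_ d d0) [N _ HN] := @cvgn_expr0 K q Kc q1.
apply: (@bounded_ratio _ (fun k => `|cauchy_term q z v k|) r N)
  => [k|||k Nk] //.
  exact: ltW.
have {HN} := HN k Nk; rewrite /= sub0r normrN normrX => qd.
have den : r * (1 - `|q| ^+ k) <= r * `|1 - q ^+ k.+1|.
  apply: ler_wpM2l; first exact: ltW.
  rewrite (le_trans _ (lerB_dist _ _)) // normr1 lerD2l lerN2 normrX exprS.
  by rewrite ler_piMl ?exprn_ge0 // ltW.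
have num : `|z - v * q ^+ k| <= `|z| + `|v| * `|q| ^+ k.
  by rewrite (le_trans (ler_normB _ _)) // normrM normrX.
have bd : `|z| + `|v| * `|q| ^+ k <= r * (1 - `|q| ^+ k).
  rewrite mulrBr mulr1 lerBrDr -addrA -mulrDl -lerBrDl mulrC.
  by rewrite -ler_pdivlMr // ltW.
have den0 : 0 < `|1 - q ^+ k.+1| by rewrite normr_gt0 one_sub_expr_neq0.
rewrite -(ler_pM2l den0) -normrM cauchy_termS // normrM mulrA [_ * r]mulrC.
by rewrite ler_wpM2r // (le_trans num) // (le_trans bd).
Qed.

Definition cauchy_sum (K : numFieldType) (q z v : K) : K :=
  limn (fun n => \sum_(k < n) cauchy_term q z v k).

Lemma cauchy_sum_cvg (K : numFieldType) (q z v : K) : series_complete K ->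
  `|q| < 1 -> `|z| < 1 ->
  \sum_(k < n) cauchy_term q z v k @[n --> \oo] --> cauchy_sum q z v.
Proof.
by move=> Kc q1 z1; have [M /Kc] := cauchy_term_bounded v Kc q1 z1.
Qed.

Lemma cauchy_sum_rec (K : numFieldType) (q z v : K) : series_complete K ->
  `|q| < 1 -> `|z| < 1 ->
  (1 - z) * cauchy_sum q z v = (1 - v) * cauchy_sum q (z * q) (v * q).
Proof.
move=> Kc q1 z1.
have zq1 : `|z * q| < 1 by rewrite normrM mulr_ilt1.
pose s N := \sum_(k < N) cauchy_term q z v k.
pose t N := \sum_(k < N) cauchy_term q (z * q) (v * q) k.
have sc : s N @[N --> \oo] --> cauchy_sum q z v by exact: cauchy_sum_cvg.
have tc : t N @[N --> \oo] --> cauchy_sum q (z * q) (v * q).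
  exact: cauchy_sum_cvg.
(* With c_k the terms of [s], the difference has terms (1 - q^k) c_k. The one at k = 0 vanishes, and
   the others become (z - v q^k) c_k after an index shift, whence [N.+1] against [N]. *)
have st N : s N.+1 - t N.+1 = z * s N - v * t N.
  have tE m : t m = \sum_(k < m) q ^+ k * cauchy_term q z v k.
    by apply: eq_bigr => k _; rewrite -{1 2}[q]expr1 cauchy_term_shift mul1n.
  rewrite !tE /s -sumrB big_ord_recl expr0 mul1r subrr add0r.
  rewrite !mulr_sumr -sumrB; apply: eq_bigr => k _.
  rewrite lift0 -{1}[cauchy_term _ _ _ _]mul1r -mulrBl cauchy_termS //.
  by rewrite mulrBl mulrA.
have lhs : s N.+1 - t N.+1 @[N --> \oo] -->
    cauchy_sum q z v - cauchy_sum q (z * q) (v * q).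
  by apply: cvgB; apply: cvgnS.
have rhs : z * s N - v * t N @[N --> \oo] -->
    z * cauchy_sum q z v - v * cauchy_sum q (z * q) (v * q).
  by apply: cvgB; apply: cvgMl_tmp.
rewrite (_ : (fun N => _) = fun N => z * s N - v * t N) in lhs; last first.
  exact/funext.
move: (cvgn_unique lhs rhs) => /eqP.
rewrite subr_eq => /eqP e; rewrite !mulrBl !mul1r {1}e; ring.
Qed.

Lemma qpochS (K : numFieldType) (a q : K) (n : nat) :
  qpoch a q n.+1 = qpoch a q n * (1 - a * q ^+ n).
Proof. by rewrite /qpoch big_ord_recr. Qed.

Lemma qpoch0l (K : numFieldType) (q : K) (n : nat) : qpoch 0 q n = 1.
Proof. by rewrite /qpoch big1 // => k _; rewrite mul0r subr0. Qed.

Lemma norm_mul_expr_lt1 (K : numFieldType) (q z : K) (n : nat) :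
  `|q| < 1 -> `|z| < 1 -> `|z * q ^+ n| < 1.
Proof.
move=> q1 z1; rewrite normrM normrX (le_lt_trans _ z1) // ler_piMr //.
by rewrite exprn_ile1 // ltW.
Qed.

Lemma cauchy_sum_iter (K : numFieldType) (q z v : K) (n : nat) :
  series_complete K -> `|q| < 1 -> `|z| < 1 ->
  qpoch z q n * cauchy_sum q z v =
  qpoch v q n * cauchy_sum q (z * q ^+ n) (v * q ^+ n).
Proof.
move=> Kc q1 z1; elim: n => [|n IH].
  by rewrite /qpoch !big_ord0 expr0 !mulr1.
rewrite !qpochS mulrAC IH exprSr !mulrA -[RHS]mulrA -cauchy_sum_rec //.
  by rewrite [RHS]mulrC; ring.
exact: norm_mul_expr_lt1.
Qed.

(** The term of index 0 is 1, and every later term carries a factor q^(n k) with k >= 1, so the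
    remainder is at most |q|^n M. *)
Lemma cauchy_sum_shift_cvg (K : numFieldType) (q z v : K) :
  series_complete K -> `|q| < 1 -> `|z| < 1 ->
  cauchy_sum q (z * q ^+ n) (v * q ^+ n) @[n --> \oo] --> (1 : K).
Proof.
move=> Kc q1 z1; have [M HM] := cauchy_term_bounded v Kc q1 z1.
have bd n : `|1 - cauchy_sum q (z * q ^+ n) (v * q ^+ n)| <= `|q| ^+ n * M.
  apply: (@cvgn_le _ (fun N => `|1 - \sum_(k < N.+1)
      cauchy_term q (z * q ^+ n) (v * q ^+ n) k|)); last first.
    apply: cvg_norm; apply: cvgB; first exact: cvg_cst.
    apply: (cvgnS (x := fun N => \sum_(k < N) _)).
    by apply: cauchy_sum_cvg => //; exact: norm_mul_expr_lt1.
  move=> N; rewrite big_ord_recl {1}/cauchy_term big_ord0 opprD addrA subrr.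
  rewrite add0r normrN (le_trans (ler_norm_sum _ _ _)) //.
  apply: le_trans (ler_wpM2l _ (HM N.+1)); last by rewrite exprn_ge0.
  rewrite big_ord_recl mulrDr mulr_sumr ler_wpDl ?mulr_ge0 ?exprn_ge0 //.
  apply: ler_sum => k _; rewrite cauchy_term_shift normrM ler_wpM2r //.
  rewrite lift0 normrX mulnS exprD ler_piMr ?exprn_ge0 //.
  by rewrite exprn_ile1 // ltW.
have qM : `|q| ^+ n * M @[n --> \oo] --> 0 * M.
  by apply: cvgMr_tmp; apply: cvgn_expr0; rewrite ?normr_id.
rewrite mul0r in qM; move/cvgrPdist_le: qM => qM.
apply/cvgrPdist_le => e /qM; apply: filterS => n; rewrite sub0r normrN.
(* The order of [K] is partial; |q|^n M is real because it bounds a norm. *)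
apply: le_trans; apply: le_trans (bd n) _; apply: real_ler_norm.
by apply: ger0_real; apply: le_trans (bd n).
Qed.

(** At z = 0 the iterated recursion reads G(0, a) = (a; q)_n G(0, a q^n). Dividing by the last
    factor, which tends to 1, gives both the convergence of the infinite product and Euler's value
    for it. *)
Lemma qpoch_cvg_euler (K : numFieldType) (q a : K) :
  series_complete K -> `|q| < 1 ->
  qpoch a q n @[n --> \oo] --> cauchy_sum q 0 a.
Proof.
move=> Kc q1; have z1 : `|0 : K| < 1 by rewrite normr0.
have Gc := cauchy_sum_shift_cvg a Kc q1 z1.
have : cauchy_sum q 0 a * (cauchy_sum q (0 * q ^+ n) (a * q ^+ n))^-1
    @[n --> \oo] --> cauchy_sum q 0 a * 1^-1.
  by apply: cvgMl_tmp; apply: cvgV => //; exact: oner_neq0.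
rewrite invr1 mulr1; apply: cvg_trans; apply: near_eq_cvg.
(* At distance less than 1 from 1 the factor is nonzero, so the division is legitimate for large
   n. *)
move/cvgrPdist_lt: Gc => /(_ 1 ltr01); apply: filterS => n Gn.
have := cauchy_sum_iter a n Kc q1 z1; rewrite qpoch0l mul1r => ->.
rewrite mulfK //; apply/negP => /eqP G0.
by move: Gn; rewrite G0 subr0 normr1 ltxx.
Qed.

Lemma qpoch_cvg (K : numFieldType) (q a : K) :
  series_complete K -> `|q| < 1 ->
  qpoch a q n @[n --> \oo] --> qpoch_inf a q.
Proof.
by move=> Kc q1; rewrite /qpoch_inf (limn_eq (qpoch_cvg_euler Kc q1 (a := a)));
  exact: qpoch_cvg_euler.
Qed.

Lemma euler_sum (K : numFieldType) (q a : K) :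
  series_complete K -> `|q| < 1 ->
  \sum_(k < n) cauchy_term q 0 a k @[n --> \oo] --> qpoch_inf a q.
Proof.
move=> Kc q1; rewrite /qpoch_inf (limn_eq (qpoch_cvg_euler Kc q1 (a := a))).
by apply: cauchy_sum_cvg => //; rewrite normr0.
Qed.

Lemma qpoch_inf_cauchy (K : numFieldType) (q z v : K) :
  series_complete K -> `|q| < 1 -> `|z| < 1 ->
  qpoch_inf z q * cauchy_sum q z v = qpoch_inf v q.
Proof.
move=> Kc q1 z1.
have lhs : qpoch z q n * cauchy_sum q z v @[n --> \oo] -->
    qpoch_inf z q * cauchy_sum q z v.
  by apply: cvgMr_tmp; exact: qpoch_cvg.
have rhs : qpoch v q n * cauchy_sum q (z * q ^+ n) (v * q ^+ n) @[n --> \oo]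
    --> qpoch_inf v q * 1.
  by apply: cvgM; [exact: qpoch_cvg|exact: cauchy_sum_shift_cvg].
rewrite mulr1 in rhs; apply: cvgn_unique rhs.
rewrite (_ : (fun n => _) = fun n => qpoch z q n * cauchy_sum q z v) //.
by apply/funext => n; rewrite cauchy_sum_iter.
Qed.

(** The case v = 0 exhibits an inverse: (z; q)_oo G(z, 0) = (0; q)_oo = 1. *)
Lemma qpoch_inf_neq0 (K : numFieldType) (q z : K) :
  series_complete K -> `|q| < 1 -> `|z| < 1 -> qpoch_inf z q != 0.
Proof.
move=> Kc q1 z1; apply/negP => /eqP e.
have := qpoch_inf_cauchy 0 Kc q1 z1; rewrite e mul0r.
rewrite /qpoch_inf (_ : (fun n => _) = fun=> 1).
  by rewrite (limn_eq (cvg_cst _)) => /esym/eqP; rewrite oner_eq0.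
by apply/funext => n; rewrite qpoch0l.
Qed.

Lemma qbinomial_sum (K : numFieldType) (q z v : K) :
  series_complete K -> `|q| < 1 -> `|z| < 1 ->
  \sum_(k < n) cauchy_term q z v k @[n --> \oo] -->
  qpoch_inf v q / qpoch_inf z q.
Proof.
move=> Kc q1 z1; rewrite -(qpoch_inf_cauchy v Kc q1 z1) mulrAC.
by rewrite divff ?qpoch_inf_neq0 // mul1r; exact: cauchy_sum_cvg.
Qed.

(** * Dominated summation of double series *)

Lemma cvgn_sum (K : numFieldType) (x : nat -> nat -> K) (l : nat -> K)
    (m : nat) :
  (forall j, x n j @[n --> \oo] --> l j) ->
  \sum_(j < m) x n j @[n --> \oo] --> \sum_(j < m) l j.
Proof.
move=> xl; elim: m => [|m IH].
  under eq_fun do rewrite big_ord0; rewrite big_ord0; exact: cvg_cst.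
under eq_fun do rewrite big_ord_recr /=; rewrite big_ord_recr /=.
exact: cvgD.
Qed.

Definition box (n m : nat) : seq (nat * nat) :=
  [seq (i, j) | j <- iota 0 m, i <- iota 0 n].

Lemma mem_box n m x : (x \in box n m) = (x.1 < n)%N && (x.2 < m)%N.
Proof.
apply/allpairsP/idP => [[[j i]] /= []|].
  by rewrite !mem_iota !add0n /= => jm il -> /=; rewrite il jm.
case: x => i j /= /andP [il jm]; exists (j, i).
by rewrite /= !mem_iota !add0n /=.
Qed.

Lemma box_uniq n m : uniq (box n m).
Proof.
by apply: allpairs_uniq; rewrite ?iota_uniq // => -[a b] [c d] _ _ [-> ->].
Qed.

Lemma sum_box (V : nmodType) (h : nat -> nat -> V) n m :
  \sum_(x <- box n m) h x.1 x.2 = \sum_(j < m) \sum_(i < n) h i j.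
Proof.
rewrite /box big_allpairs_dep /= -{1}[m]subn0 -/(index_iota 0 m) big_mkord.
apply: eq_bigr => j _.
by rewrite -{1}[n]subn0 -/(index_iota 0 n) big_mkord.
Qed.

Lemma sum_sub_seq (V : nmodType) (T : eqType) (h : T -> V) (s t : seq T) :
  uniq s -> uniq t -> {subset s <= t} ->
  \sum_(x <- t | x \in s) h x = \sum_(x <- s) h x.
Proof.
move=> us ut st; rewrite -big_filter; apply: perm_big.
apply: uniq_perm; rewrite ?filter_uniq // => x.
by rewrite mem_filter andb_idr //; exact: st.
Qed.

Lemma box_cover (A : {fset nat * nat}) :
  exists b, forall n m, (b <= n)%N -> (b <= m)%N -> {subset A <= box n m}.
Proof.
exists (\max_(x <- A) maxn x.1 x.2).+1 => n m bn bm x xA; rewrite mem_box.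
have := @leq_bigmax_seq _ (enum_fset A) xpredT (fun x => maxn x.1 x.2) x xA isT.
by rewrite geq_max => /andP[x1 x2]; rewrite (leq_trans _ bn) ?(leq_trans _ bm).
Qed.

(** A box [n0] by [m0] carries all but 2d of the mass [L]. A finite set [A] containing it fits in a
    larger box whose [f]-sum is within 2d of [l], and the entries of that box outside [A] contribute
    at most 2d. *)
Lemma dominated_double_sum (K : numFieldType) (f F : nat -> nat -> K)
    (g G : nat -> K) (l L : K) :
  (forall i j, `|f i j| <= F i j) ->
  (forall j, \sum_(i < n) f i j @[n --> \oo] --> g j) ->
  \sum_(j < n) g j @[n --> \oo] --> l ->
  (forall j, \sum_(i < n) F i j @[n --> \oo] --> G j) ->
  \sum_(j < n) G j @[n --> \oo] --> L ->
  has_double_sum f l.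
Proof.
move=> fF fg gl FG GL.
have F0 i j : 0 <= F i j by apply: le_trans (fF i j).
have G0 j : 0 <= G j.
  by apply: cvgn_ge0 (FG j) => n; apply: sumr_ge0.
have FF : Filter (@totally (nat * nat)%type) by exact: totally_filter.
apply/cvgrPdist_le => e e0; pose d := e / 4.
have d0 : 0 < d by rewrite divr_gt0.
have [m0 Hm0] : exists m, L - \sum_(j < m) G j <= d.
  have /cvgrPdist_le /(_ d d0) [m _ /(_ m (leqnn m)) /= H] := GL; exists m.
  apply: le_trans H; rewrite ger0_norm // subr_ge0.
  exact: psum_le_lim G0 GL m.
have [n0 Hn0] :
    exists n, \sum_(j < m0) G j - \sum_(j < m0) \sum_(i < n) F i j <= d.
  have /cvgrPdist_le /(_ d d0) [n _ /(_ n (leqnn n)) /= H] :=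
    cvgn_sum (m := m0) FG.
  exists n; apply: le_trans H; rewrite ger0_norm // -sumrB.
  apply: sumr_ge0 => j _; rewrite subr_ge0.
  exact: psum_le_lim (F0^~ j) (FG j) _.
have {Hm0 Hn0} tail : L - \sum_(x <- box n0 m0) F x.1 x.2 <= d + d.
  by rewrite sum_box; have := lerD Hm0 Hn0; rewrite addrA subrK.
exists [fset x in box n0 m0]%fset => // A /fsubsetP A0A.
rewrite /partial_sum -(big_seq_fsetE _ _ xpredT (fun x => f x.1 x.2)) /=.
have [b Hb] := box_cover A.
move/cvgrPdist_le: gl => /(_ d d0) [m1 _ Hm1].
(* [m] is fixed before [n], since the rate of convergence of the m inner sums depends on [m]; both
   are at least [b] so that the box contains [A]. *)
pose m := maxn b m1.
have {Hm1} Hm : `|l - \sum_(j < m) g j| <= d by apply: Hm1; exact: leq_maxr.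
have /cvgrPdist_le /(_ d d0) [n1 _ Hn1] := cvgn_sum (m := m) fg.
pose n := maxn b n1.
have {Hn1} Hn : `|\sum_(j < m) g j - \sum_(j < m) \sum_(i < n) f i j| <= d.
  by apply: Hn1; exact: leq_maxr.
have {Hb} AB : {subset A <= box n m} by apply: Hb; exact: leq_maxl.
have rest : `|\sum_(x <- box n m | x \notin A) f x.1 x.2| <= d + d.
  rewrite (le_trans (ler_norm_sum _ _ _)) //.
  have s0 : {subset box n0 m0 <= box n m}.
    by move=> x x0; apply: AB; apply: A0A; rewrite !inE.
  rewrite (@le_trans _ _
    (\sum_(x <- box n m | x \notin box n0 m0) F x.1 x.2)) //.
    rewrite big_mkcond [leRHS]big_mkcond; apply: ler_sum => x _.
    case: ifP => xA; last by case: ifP.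
    rewrite ifT //; apply: contra xA => x0; apply: A0A; rewrite !inE //.
  (* The larger box has [F]-sum at most [L], so what it adds to the small box is at most the
     tail. *)
  apply: le_trans tail; rewrite lerBrDr.
  have := sum_box F n m; rewrite (bigID (fun x => x \in box n0 m0)) /=.
  rewrite sum_sub_seq ?box_uniq // addrC => ->.
  apply: le_trans (psum_le_lim G0 GL m).
  by apply: ler_sum => j _; exact: psum_le_lim (F0^~ j) (FG j) _.
rewrite -sum_box (bigID (fun x => x \in A)) /= in Hn.
rewrite sum_sub_seq ?box_uniq ?fset_uniq // in Hn.
set s := \sum_(x <- A) _ in Hn *; set r := \sum_(x <- _ | _) _ in rest Hn.
set t := \sum_(j < m) _ in Hm Hn.
have -> : l - s = (l - t) + (t - (s + r)) + r by ring.
rewrite (le_trans (ler_normD _ _)) //.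
have -> : e = d + d + (d + d) by rewrite /d; field.
by rewrite lerD // (le_trans (ler_normD _ _)) // lerD.
Qed.

(** * The double series and its iterated sums *)

(** Since n^2 - n = 2 C(n, 2), the numerator is an exact double. This form isolates the mixed factor
    q^(- i j). *)
Lemma qexponentE (i j : nat) :
  qexponent i j = 'C(i, 2)%:Z + 'C(j, 2)%:Z - (i * j)%:Z.
Proof.
have two n : n%:Z ^+ 2 - n%:Z = 'C(n, 2)%:Z * 2.
  elim: n => [|n IH]; first by rewrite bin0n.
  by rewrite binS bin1 PoszD mulrDl -IH intS; ring.
rewrite /qexponent (_ : _ - _ = ('C(i, 2)%:Z + 'C(j, 2)%:Z - (i * j)%:Z) * 2).
  by rewrite mulzK.
by rewrite mulrBl mulrDl -!two PoszM; ring.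
Qed.

Lemma cauchy_term0 (K : numFieldType) (q a : K) (i : nat) : `|q| < 1 ->
  cauchy_term q 0 a i = (- a) ^+ i * q ^+ 'C(i, 2) / qpoch q q i.
Proof.
move=> q1; rewrite /cauchy_term /qpoch prodf_div.
congr (_ / _); last by apply: eq_bigr => k _; rewrite exprS.
elim: i => [|i IH]; first by rewrite big_ord0 !expr0 mulr1.
by rewrite big_ord_recr /= IH binS bin1 addnC exprD exprS sub0r; ring.
Qed.

Lemma qpoch_neq0 (K : numFieldType) (q : K) (n : nat) :
  `|q| < 1 -> qpoch q q n != 0.
Proof.
move=> q1; apply/prodf_neq0 => k _.
by rewrite -exprS one_sub_expr_neq0.
Qed.

Definition double_term (K : numFieldType) (q u v : K) (i j : nat) : K :=
  (-1) ^+ (i + j) * u ^+ i * v ^+ j * q ^ qexponent i j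
    / (qpoch q q i * qpoch q q j).

(** The mixed factor q^(- i j) is absorbed into u^i as (u / q^j)^i, which leaves an Euler term in i
    for each fixed j. *)
Lemma double_termE (K : numFieldType) (q u v : K) (i j : nat) :
  q != 0 -> `|q| < 1 ->
  double_term q u v i j = cauchy_term q 0 v j * cauchy_term q 0 (u / q ^+ j) i.
Proof.
move=> q0 q1; rewrite /double_term qexponentE !cauchy_term0 // !expfzDr //.
rewrite -exprnN -!exprnP -mulNr exprMn -[- u]mulN1r -[- v]mulN1r !exprMn.
rewrite exprVn -exprM exprD [(j * i)%N]mulnC; field.
by rewrite !qpoch_neq0 // expf_neq0.
Qed.

Lemma qpochD (K : numFieldType) (a q : K) (m n : nat) :
  qpoch a q (m + n) = qpoch a q m * qpoch (a * q ^+ m) q n.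
Proof.
rewrite /qpoch big_split_ord /=; congr (_ * _).
by apply: eq_bigr => k _; rewrite exprD mulrA.
Qed.

Lemma qpoch_inf_shift (K : numFieldType) (a q : K) (m : nat) :
  series_complete K -> `|q| < 1 ->
  qpoch_inf a q = qpoch a q m * qpoch_inf (a * q ^+ m) q.
Proof.
move=> Kc q1; apply: limn_eq; rewrite -(cvg_shiftn m) /=.
under eq_fun do rewrite addnC qpochD.
by apply: cvgMl_tmp; exact: qpoch_cvg.
Qed.

(** After reversal the finite product has factors 1 - u q^(-k-1), and (- v q^k)(1 - u q^(-k-1)) = u
    v / q - v q^k. *)
Lemma cauchy_term_qpoch (K : numFieldType) (q u v : K) (j : nat) : q != 0 ->
  cauchy_term q 0 v j * qpoch (u / q ^+ j) q j = cauchy_term q (u * v / q) v j.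
Proof.
move=> q0; rewrite /qpoch (reindex_inj rev_ord_inj) /cauchy_term -big_split /=.
apply: eq_bigr => k _; rewrite mulrAC; congr (_ / _).
rewrite -mulrA -{2}(subnK (ltn_ord k)) exprD invfM [_^-1 * _^-1]mulrC.
rewrite -[_ / _ * _]mulrA mulVf ?expf_neq0 // exprS.
by field; rewrite q0 expf_neq0.
Qed.

Lemma double_term_row (K : numFieldType) (q u v : K) (j : nat) :
  series_complete K -> q != 0 -> `|q| < 1 ->
  \sum_(i < n) double_term q u v i j @[n --> \oo] -->
  cauchy_term q (u * v / q) v j * qpoch_inf u q.
Proof.
move=> Kc q0 q1; under eq_fun do under eq_bigr do rewrite double_termE //.
under eq_fun do rewrite -mulr_sumr.
(* Writing u as (u / q^j) q^j lets the finite and infinite products merge into (u / q^j; q)_oo. *)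
rewrite -cauchy_term_qpoch // -mulrA -{2}[u](@divfK _ (q ^+ j)) ?expf_neq0 //.
rewrite -qpoch_inf_shift //; apply: cvgMl_tmp; exact: euler_sum.
Qed.

Lemma double_term_total (K : numFieldType) (q u v : K) :
  series_complete K -> q != 0 -> `|q| < 1 -> `|u * v| < `|q| ->
  \sum_(j < n) (cauchy_term q (u * v / q) v j * qpoch_inf u q) @[n --> \oo] -->
  qpoch_inf u q * qpoch_inf v q / qpoch_inf (u * v / q) q.
Proof.
move=> Kc q0 q1 uvq; under eq_fun do rewrite -mulr_suml.
rewrite -mulrA mulrC; apply: cvgMr_tmp; apply: qbinomial_sum => //.
(* The condition |u v| < |q| is exactly |z| < 1 for z = u v / q. *)
by rewrite normrM normfV ltr_pdivrMr ?normr_gt0 // mul1r.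
Qed.

(** * The majorant and absolute convergence *)

Lemma qpoch_norm (K : numFieldType) (q : K) (n : nat) : `|q| < 1 ->
  0 < qpoch `|q| `|q| n <= `|qpoch q q n|.
Proof.
move=> q1; rewrite /qpoch normr_prod prodr_gt0 => [/=|k _]; last first.
  by rewrite subr_gt0 -exprS exprn_ilt1.
apply: ler_prod => k _; rewrite -!exprS subr_ge0 exprn_ile1 ?(ltW q1) //=.
by rewrite (le_trans _ (lerB_dist _ _)) // normr1 normrX.
Qed.

Lemma norm_exprz (K : numFieldType) (q : K) (m : int) : `|q ^ m| = `|q| ^ m.
Proof. by case: m => n; rewrite /exprz ?normfV normrX. Qed.

(** The signs of [- |u|] and [- |v|] cancel (-1)^(i+j), so the numerators agree in norm; only the
    denominators change, and they shrink because |1 - q^k| >= 1 - |q|^k. *)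
Lemma double_term_dominated (K : numFieldType) (q u v : K) (i j : nat) :
  `|q| < 1 ->
  `|double_term q u v i j| <= double_term `|q| (- `|u|) (- `|v|) i j.
Proof.
move=> q1; rewrite /double_term normf_div !normrM !normrX normrN1 expr1n mul1r.
rewrite -[- `|u|]mulN1r -[- `|v|]mulN1r !exprMn exprD.
rewrite (_ : _ * _ * (_ * `|u| ^+ i) * (_ * `|v| ^+ j) = `|u| ^+ i * `|v| ^+ j).
  rewrite norm_exprz ler_wpM2l ?mulr_ge0 ?exprn_ge0 ?exprz_ge0 //.
  have /andP[i0 ii] := qpoch_norm i q1; have /andP[j0 jj] := qpoch_norm j q1.
  rewrite lef_pV2 ?posrE ?mulr_gt0 //; first by rewrite ler_pM // ltW.
  - exact: lt_le_trans ii.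
  - exact: lt_le_trans jj.
have sgn n : (-1) ^+ n * (-1) ^+ n = 1 :> K by rewrite -expr2 sqrr_sign.
transitivity (((-1) ^+ i * (-1) ^+ i) * ((-1) ^+ j * (-1) ^+ j) *
  (`|u| ^+ i * `|v| ^+ j)); last by rewrite !sgn !mul1r.
by ring.
Qed.

Lemma double_sum_qpoch (K : numFieldType) (q u v : K) :
  series_complete K -> 0 < `|q| -> `|q| < 1 -> `|u * v| < `|q| ->
  has_double_sum (double_term q u v)
    (qpoch_inf u q * qpoch_inf v q / qpoch_inf (u * v / q) q).
Proof.
move=> Kc q0 q1 uvq; have q0' : q != 0 by rewrite -normr_gt0.
have p0 : `|q| != 0 by rewrite normr_eq0.
have p1 : `| `|q| | < 1 by rewrite normr_id.
apply: dominated_double_sum.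
- by move=> i j; exact: double_term_dominated q1.
- by move=> j; exact: double_term_row.
- exact: double_term_total.
- by move=> j; exact: double_term_row.
(* For the majorant the product of parameters is (- |u|)(- |v|) = |u v|, so the same hypothesis
   applies. *)
- by apply: double_term_total => //; rewrite mulrNN -normrM !normr_id.
Qed.

(** * Completeness of the real and complex numbers *)

Lemma real_series_complete (R : realType) : series_complete R.
Proof.
move=> a M aM; rewrite (_ : (fun n => _) = series a); last first.
  by apply/funext => n; rewrite /series /= big_mkord.
apply: normed_cvg; apply: nondecreasing_is_cvgn.
  by apply: nondecreasing_series => n _ _; rewrite normr_ge0.
exists M => _ [n _ <-].
by have := aM n; rewrite -(big_mkord xpredT (fun k => `|a k|)).
Qed.

Lemma complex_norm (R : rcfType) (x y : R) :
  `|(x +i* y)%C| = (Num.sqrt (x ^+ 2 + y ^+ 2))%:C%C.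
Proof. by rewrite normc_def. Qed.

Lemma complex_sum (R : rcfType) (x y : nat -> R) n :
  \sum_(k < n) (x k +i* y k)%C =
  ((\sum_(k < n) x k) +i* (\sum_(k < n) y k))%C.
Proof.
elim: n => [|n IH]; first by rewrite !big_ord0.
by rewrite !big_ord_recr /= IH.
Qed.

Lemma complex_series_complete (R : realType) : series_complete R[i].
Proof.
move=> a M aM.
pose x k := complex.Re (a k); pose y k := complex.Im (a k).
have aE k : a k = (x k +i* y k)%C by rewrite /x /y; case: (a k).
(* In [R[i]] an inequality means equal imaginary parts and ordered real parts, so the bound descends
   to the real part of [M]. *)
have bd n : \sum_(k < n) Num.sqrt (x k ^+ 2 + y k ^+ 2) <= complex.Re M.
  have := aM n; under eq_bigr do rewrite aE complex_norm.
  by rewrite -(rmorph_sum (real_complex R)) lecE => /andP[].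
have xc : cvgn (fun n => \sum_(k < n) x k).
  apply: (@real_series_complete R _ (complex.Re M)) => n.
  apply: le_trans (bd n); apply: ler_sum => k _.
  by rewrite -sqrtr_sqr ler_wsqrtr // lerDl sqr_ge0.
have yc : cvgn (fun n => \sum_(k < n) y k).
  apply: (@real_series_complete R _ (complex.Re M)) => n.
  apply: le_trans (bd n); apply: ler_sum => k _.
  by rewrite -sqrtr_sqr ler_wsqrtr // lerDr sqr_ge0.
apply/cvg_ex; exists (limn (fun n => \sum_(k < n) x k) +i*
  limn (fun n => \sum_(k < n) y k))%C.
have sE n : \sum_(k < n) a k = ((\sum_(k < n) x k) +i* (\sum_(k < n) y k))%C.
  by rewrite -complex_sum; apply: eq_bigr.
under eq_fun do rewrite sE.
apply/cvgrPdist_le => -[e e'] /= /[!ltcE] /= /andP[/eqP -> e0].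
have e20 : 0 < e / 2 by rewrite divr_gt0.
move/cvgrPdist_le: xc => /(_ _ e20) xc.
move/cvgrPdist_le: yc => /(_ _ e20) yc.
apply: filterS2 xc yc => n xn yn.
rewrite (complex_norm (_ - _) (_ - _)) lecR.
apply: le_trans (_ : e / 2 + e / 2 <= e); last by rewrite -splitr.
apply: le_trans (lerD xn yn).
(* The modulus is at most the sum of the absolute values of the two parts, by comparing squares. *)
rewrite -[leRHS]ger0_norm ?addr_ge0 // -sqrtr_sqr ler_wsqrtr //.
rewrite [leRHS]sqrrD !real_normK ?num_real // lerD2r lerDl.
by rewrite mulrn_wge0 // mulr_ge0.
Qed.

Theorem theorem3p1 (R : realType) (q u v : R[i])
    (q_gt0 : 0 < `|q|) (q_lt1 : `|q| < 1) (uv_lt_q : `|u * v| < `|q|) :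
  has_double_sum
    (fun i j : nat =>
       (-1) ^+ (i + j) * u ^+ i * v ^+ j * q ^ qexponent i j
         / (qpoch q q i * qpoch q q j))
    (qpoch_inf u q * qpoch_inf v q / qpoch_inf (u * v / q) q).
Proof.
exact: double_sum_qpoch (@complex_series_complete R) q_gt0 q_lt1 uv_lt_q.
Qed.
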